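(* Let $F$ be an arbitrary field and let $Z$ be a finite-dimensional Zinbiel algebra over $F$. Then $Z$ is nilpotent; that is, there exists $n \in \mathbb{N}$, $n\ge 1$, such that $Z^n = 0$.
   Context: A Zinbiel algebra over a field $F$ is an $F$-vector space $Z$ with a bilinear product $[\cdot,\cdot]: Z\times Z\to Z$ satisfying $[[x,y],z]=[x,[y,z]]+[x,[z,y]]$ for all $x,y,z\in Z$. For subspaces $U,V$ of $Z$, $[U,V]$ denotes the linear span of all products $[u,v]$ with $u\in U$, $v\in V$. The series $Z^k$ is defined by $Z^1=Z$ and $Z^{k+1}=[Z,Z^k]$ for all $k\geq 1$. The algebra $Z$ is called nilpotent if $Z^n=0$ for some $n$. *)

(* Defs.v *)
From mathcomp Require Import all_boot all_order all_algebra.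

Set Implicit Arguments.
Unset Strict Implicit.
Unset Printing Implicit Defensive.

Import GRing.Theory.
Local Open Scope ring_scope.

Definition zinbiel_identity (F : fieldType) (Z : lmodType F)
    (br : {bilinear Z -> Z -> Z}) : Prop :=
  forall x y z : Z, br (br x y) z = br x (br y z) + br x (br z y).

Section Brackets.

Variables (F : fieldType) (Z : vectType F) (br : {bilinear Z -> Z -> Z}).
Implicit Types U V W : {vspace Z}.

(* The subspace [U, V]. As for prodv in mathcomp.field.falgebra, it is spanned
   by the products of basis vectors; memv_bracketv and bracketvP show that it
   is the least subspace containing every product of an element of U by an
   element of V. *)
Definition bracketv U V : {vspace Z} :=
  <<[seq br u v | u <- vbasis U, v <- vbasis V]>>%VS.

Lemma memv_bracketv U V : {in U & V, forall u v, br u v \in bracketv U V}.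
Proof.
move=> u v /coord_vbasis-> /coord_vbasis->.
rewrite linear_sumlz; apply: memv_suml => i _.
rewrite linear_sumr; apply: memv_suml => j _.
rewrite linearZl_LR linearZr_LR !memvZ // memv_span //.
by apply/allpairsP; exists ((vbasis U)`_i, (vbasis V)`_j); rewrite !memt_nth.
Qed.

Lemma bracketvP U V W :
  reflect {in U & V, forall u v, br u v \in W} (bracketv U V <= W)%VS.
Proof.
apply: (iffP idP) => [sUVW u v Uu Vv | sUVW].
  by rewrite (subvP sUVW) ?memv_bracketv.
by apply/span_subvP=> _ /allpairsP[[u v] /= [/vbasis_mem Uu /vbasis_mem Vv ->]];
  apply: sUVW.
Qed.

(* Z^k for k >= 1; the value at k = 0 is a junk value. *)
Definition zinbiel_pow (k : nat) : {vspace Z} := iter k.-1 (bracketv fullv) fullv.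

Lemma zinbiel_pow1 : zinbiel_pow 1 = fullv.
Proof. by []. Qed.

Lemma zinbiel_powS k : (1 <= k)%N ->
  zinbiel_pow k.+1 = bracketv fullv (zinbiel_pow k).
Proof. by case: k. Qed.

End Brackets.

Definition zinbiel_nilpotent (F : fieldType) (Z : vectType F)
    (br : {bilinear Z -> Z -> Z}) : Prop :=
  exists n : nat, (1 <= n)%N /\ zinbiel_pow br n = 0%VS.

(* Main.v *)
(** Write [x o y = xy + yx]. The Zinbiel identity says [(xy)z = x(y o z)], whence
    [o] is commutative and associative, and right multiplications satisfy
    [R_z R_y = R_(y o z)]. An idempotent [f] of [o] has [f = 2 ff], and
    [(ff)f = f(f o f) = ff] gives [ff = 2 ff], so [f = 0], in every
    characteristic; by Fitting's lemma all [o]-powers eventually vanish, and all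
    right multiplications are commuting nilpotent operators. Thus every proper
    ideal [I] admits [z] outside [I] with [zZ] inside [I]. Modulo [I], right
    multiplication by [z] commutes with all left multiplications and squares to
    zero. Hence if [Z^n] lies in the larger ideal [I + Zz + Fz], then
    [Z^(n+1)] lies in [I + Zz] and [Z^(2n+1)] in [I + (Z^(n+1))z], which is [I]. *)
Require Import Defs.
From mathcomp Require Import all_boot all_order all_algebra.

Set Implicit Arguments.
Unset Strict Implicit.
Unset Printing Implicit Defensive.

Import GRing.Theory.
Local Open Scope ring_scope.

(** The images of the iterates of [h] form a descending chain, which finite dimension forces to
    repeat; one repetition makes it constant from there on. *)
Lemma fitting_stable (F : fieldType) (V : vectType F) (h : 'End(V)) :
  exists N, forall k z, exists t, iter N h z = iter (N + k) h t.
Proof.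
pose U k := iter k (fun W => h @: W)%VS (fullv : {vspace V}).
have memU k x : iter k h x \in U k.
  by elim: k => [|k IH] /=; rewrite ?memvf // memv_img.
have Umem k x : x \in U k -> exists t, x = iter k h t.
  elim: k x => [|k IH] x /=; first by exists x.
  by move=> /memv_imgP[u /IH[t ->] ->]; exists t.
have subU k : (U k.+1 <= U k)%VS.
  by elim: k => [|k IH]; rewrite ?subvf //= limgS.
have [N eqN] : exists N, U N.+1 = U N.
  suff H d k : (\dim (U k) <= d)%N -> exists N, U N.+1 = U N.
    exact: (H _ 0%N (leqnn _)).
  elim: d k => [|d IH] k le_d; case: (eqVneq (U k.+1) (U k)) => [|neq];
    try by exists k.
  - move: neq; rewrite eqEdim subU /= => /negP[].
    exact: leq_trans le_d _.
  - apply: (IH k.+1); rewrite -ltnS; apply: leq_trans le_d.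
    by rewrite ltnNge; apply: contra neq => le; rewrite eqEdim subU.
exists N => k z; apply: Umem.
suff -> : U (N + k)%N = U N by [].
by elim: k => [|k IH]; rewrite ?addn0 // addnS /U iterS -/(U _) IH; exact: eqN.
Qed.

Section Zinbiel.

Variables (F : fieldType) (Z : vectType F) (br : {bilinear Z -> Z -> Z}).
Hypothesis hbr : zinbiel_identity br.

Definition zsym x y := br x y + br y x.

Lemma zsymC x y : zsym x y = zsym y x.
Proof. by rewrite /zsym addrC. Qed.

Lemma br_brl x y z : br (br x y) z = br x (zsym y z).
Proof. by rewrite hbr /zsym linearDr. Qed.

Lemma brAC x y z : br (br x y) z = br (br x z) y.
Proof. by rewrite !br_brl zsymC. Qed.

(** The left side is [(xy)z + (yz)x + (zy)x]. Since [(yz)x = (yx)z] and [(zy)x = z(y o x)], it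
    regroups into the right side. *)
Lemma zsymA x y z : zsym x (zsym y z) = zsym (zsym x y) z.
Proof.
rewrite {1}/zsym -br_brl linearDl /= [br (br y z) x]brAC addrA.
by rewrite [br (br z y) x]br_brl [zsym y x]zsymC [RHS]/zsym {2}/zsym linearDl.
Qed.

Lemma zsym_idem0 f : zsym f f = f -> f = 0.
Proof.
move=> ff; have e : br f f = br f f + br f f.
  by rewrite -{4 6}ff -br_brl -linearDl /= -/(zsym f f) ff.
have ff0 : br f f = 0 by apply: (@addrI _ (br f f)); rewrite addr0 -e.
by rewrite -ff /zsym ff0 addr0.
Qed.

Lemma iter_zsymA n y u v : zsym (iter n (zsym y) u) v = iter n (zsym y) (zsym u v).
Proof. by elim: n => //= n <-; rewrite zsymA. Qed.

Lemma zsym_nil y : exists n, iter n (zsym y) y = 0.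
Proof.
pose h : 'End(Z) := (linfun (br y) + linfun (applyr br y))%R.
have hE x : h x = zsym y x by rewrite add_lfunE !lfunE.
have [N stable] := fitting_stable h.
have {}stable z : exists t, iter N (zsym y) z = iter (N + N.+1) (zsym y) t.
  have [t et] := stable N.+1 z; exists t.
  by move: et; rewrite !(eq_iter hE).
pose c := iter N (zsym y) y.
have cE v : zsym c v = iter N.+1 (zsym y) v by rewrite iter_zsymA -iterSr.
(* Stability is used twice: first [c o f = c], then [f] lies in [c o Z]. Writing [f = c o w] gives
   [f o f = (f o c) o w = c o w = f]. *)
have [t ct] := stable y; pose f := iter N (zsym y) t.
have cf : zsym c f = c by rewrite cE /f -iterD addnC -ct.
have [s fs] := stable t.
have fE : f = zsym c (iter N (zsym y) s) by rewrite cE -iterD addnC -fs.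
have f0 : f = 0.
  by apply: zsym_idem0; rewrite {2}fE zsymA [zsym f c]zsymC cf -fE.
by exists N; rewrite -/c -cf f0 /zsym linear0l linear0r addr0.
Qed.

Lemma br_iter n x y : br x (iter n (zsym y) y) = iter n.+1 (br^~ y) x.
Proof. by elim: n x => // n IH x; rewrite iterS -br_brl IH -iterSr. Qed.

Lemma brr_nil y : exists n, forall x, iter n (br^~ y) x = 0.
Proof.
have [n yn] := zsym_nil y.
by exists n.+1 => x; rewrite -br_iter yn linear0r.
Qed.

Definition zideal (I : {vspace Z}) :=
  forall x y, x \in I -> br x y \in I /\ br y x \in I.

Lemma zideal_annihilator (I : {vspace Z}) : zideal I -> I != fullv ->
  exists2 z, z \notin I & forall y, br z y \in I.
Proof.
move=> idI ltI.
suff [z zI zP] : exists2 z, z \notin I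
    & forall y, y \in (vbasis (@fullv _ Z) : seq Z) -> br z y \in I.
  exists z => // y; rewrite (coord_vbasis (memvf y)) linear_sumr /=.
  apply: memv_suml => i _; rewrite linearZr_LR memvZ // zP //.
  exact: memt_nth.
elim: (vbasis _ : seq Z) => [|b s [z zI zP]].
  have /subvPn[z _ zI] : ~~ (fullv <= I)%VS.
    by apply: contra ltI => le; rewrite eqEsubv subvf.
  by exists z.
have iterP k y : y \in s -> br (iter k (br^~ b) z) y \in I.
  move=> ys; elim: k => [|k IH] /=; first exact: zP.
  by rewrite brAC; case: (idI _ b IH).
have [n bn] := brr_nil b.
have exn : exists k, iter k (br^~ b) z \in I by exists n; rewrite bn mem0v.
(* The new witness is the last iterate of [z] under right multiplication by [b] that is outside [I].
   By minimality [b] sends it into [I], and [iterP] keeps the earlier basis vectors. *)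
case: (ex_minnP exn) => -[|k] kI kmin; first by rewrite kI in zI.
exists (iter k (br^~ b) z); first by apply/negP=> /kmin; rewrite ltnn.
by move=> y; rewrite inE => /predU1P[->|/iterP].
Qed.

Local Notation pow := (zinbiel_pow br).
Local Notation R z := (linfun (applyr br z)).

Lemma zideal_add (I : {vspace Z}) z : zideal I -> (forall y, br z y \in I) ->
  zideal (I + (R z @: fullv + <[z]>))%VS.
Proof.
move=> idI zI _ y /memv_addP[i iI [_ /memv_addP[_ /memv_imgP[x _ ->]
  [_ /vlineP[c ->] ->]] ->]].
have imR w : br w z \in (R z @: fullv)%VS.
  by apply/memv_imgP; exists w; rewrite ?memvf ?lfunE.
have modI a b : a - b \in I -> b \in (R z @: fullv)%VS ->
    a \in (I + (R z @: fullv + <[z]>))%VS.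
  move=> aI bR; rewrite -(subrK b a); apply: memv_add => //.
  exact: (subvP (addvSl _ _)).
rewrite lfunE /= !(linearDl, linearDr) /= linearZl_LR linearZr_LR /=.
have [iyI yiI] := idI i y iI.
split.
  apply: (modI _ (br (br x y) z)); last exact: imR.
  have -> : br (br x z) y = br (br x y) z by rewrite brAC.
  by rewrite addrCA addrC addrK memvD // memvZ.
(* As [zx] lies in [I], this says that [y(xz)] and [(yx)z] agree modulo [I]. *)
have yxz : br y (br x z) = br (br y x) z - br y (br z x) by rewrite hbr addrK.
apply: (modI _ (br (br y x) z + c *: br y z)); last by rewrite memvD // memvZ.
rewrite yxz -addrA [_ - _ + _]addrAC addrAC subrr add0r memvD // memvN.
by have [] := idI _ y (zI x).
Qed.

(** Induction on the codimension of [I], passing to a strictly larger ideal. *)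
Lemma zinbiel_pow_sub_zideal (I : {vspace Z}) :
  zideal I -> exists n, (pow n.+1 <= I)%VS.
Proof.
have [d] := ubnP (\dim (@fullv _ Z) - \dim I)%N.
elim: d I => // d IH I; rewrite ltnS => le_d idI.
have [->|ltI] := eqVneq I fullv; first by exists 0%N.
have [z zI zP] := zideal_annihilator idI ltI.
have ltIJ : (\dim I < \dim (I + (R z @: fullv + <[z]>)))%N.
  rewrite ltnNge; apply: contra zI => leJ.
  have /eqP-> : I == (I + (R z @: fullv + <[z]>))%VS by rewrite eqEdim addvSl.
  by rewrite memvE (subv_trans (addvSr (R z @: fullv)%VS _)) ?addvSr.
have [n nJ] : exists n, (pow n.+1 <= I + (R z @: fullv + <[z]>))%VS.
  apply: IH (zideal_add idI zP); apply: leq_trans le_d.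
  by apply: ltn_sub2l (ltIJ); apply: leq_trans ltIJ _; exact: dimvS (subvf _).
have stepR u x : exists2 i, i \in I & br u (br x z) = i + R z (br u x).
  exists (- br u (br z x)); first by rewrite memvN; case: (idI _ u (zP x)).
  by rewrite lfunE /= hbr addrC addrK.
have powR k : (pow (n.+1 + k.+1) <= I + R z @: pow k.+1)%VS.
  elim: k => [|k IHk].
    (* One left multiplication by [u] turns the summand [c *: z] into [c *: uz], an element of
       [Zz]. *)
    rewrite addn1; apply/bracketvP => u v _ /(subvP nJ).
    move=> /memv_addP[i iI [_ /memv_addP[_ /memv_imgP[x _ ->]
      [_ /vlineP[c ->] ->]] ->]].
    have [j jI e] := stepR u x.
    rewrite [R z x]lfunE /= !linearDr /= e linearZr_LR /= !addrA -addrA.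
    apply: memv_add; first by rewrite memvD //; case: (idI _ u iI).
    rewrite memvD ?memv_img ?memvf // memvZ //.
    by apply/memv_imgP; exists u; rewrite ?memvf ?lfunE.
  rewrite addnS; apply/bracketvP => u v _ /(subvP IHk).
  move=> /memv_addP[i iI [_ /memv_imgP[x xP ->] ->]].
  have [j jI e] := stepR u x.
  rewrite [R z x]lfunE /= linearDr /= e addrA.
  apply: memv_add; first by rewrite memvD //; case: (idI _ u iI).
  by rewrite memv_img // memv_bracketv ?memvf.
(* Taking [k = n.+1] in [powR] leaves [xz] with [x] in [pow n.+2], and [powR 0] puts [x] in
   [I + Zz]. *)
exists (n.+1 + n.+1)%N; rewrite -addnS.
apply: subv_trans (powR _) _; apply/subvP => _ /memv_addP[i iI [_ /memv_imgP[x xP ->] ->]].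
apply: memvD => //.
have := powR 0%N; rewrite addn1 => /subvP/(_ _ xP).
case/memv_addP=> j jI [_ /memv_imgP[w _ ->] ->].
(* Here [(wz)z = w(zz + zz)] lies in [I] because [zz] does. *)
rewrite !lfunE /= linearDl /= br_brl /zsym linearDr /=.
have [jz _] := idI j z jI.
by have [_ ?] := idI _ w (zP z); rewrite !memvD.
Qed.

End Zinbiel.

Theorem theorem2p4 (F : fieldType) (Z : vectType F)
    (br : {bilinear Z -> Z -> Z}) (hbr : zinbiel_identity br) :
  zinbiel_nilpotent br.
Proof.
have id0 : zideal br 0%VS.
  by move=> x y; rewrite memv0 => /eqP->; rewrite linear0l linear0r mem0v.
have [n n0] := zinbiel_pow_sub_zideal hbr id0.
by exists n.+1; split=> //; apply/eqP; rewrite -subv0.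
Qed.
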